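(* Every Turing-recognizable (i.e. recursively enumerable) language $L$ belongs to $\mathsf{weak}\text{-}\mathsf{qAM}_1(1)$; that is, $L$ has a weak qAM proof system with perfect completeness whose verifier uses constant space.
   Context: **Superoperators.** A superoperator on a finite-dimensional quantum register is a finite family $\mathcal{E}=\{E_1,\dots,E_k\}$ of square matrices with rational entries with $\sum_{i=1}^k E_i^\dagger E_i=I$. Applied to a register in state $|\psi\rangle$, it yields outcome $i$ with probability $p_i=\|E_i|\psi\rangle\|^2$, and then (if $p_i>0$) the new state is $E_i|\psi\rangle/\sqrt{p_i}$. As a special one-outcome operator, the register may also be (re)initialized to a predefined state. **qAM proof systems.** A qAM proof system is a pair $(P,V)$ (prover, verifier). $V$ is a Turing machine with a two-way read-only input tape (the input is delimited by end symbols), a two-way read/write work tape, a communication cell over a finite alphabet, and a quantum register of fixed dimension (independent of the input). States of $V$ are partitioned into reading, communication, accepting and rejecting states. In a reading state, a superoperator determined by the current state and the symbols under the tape heads is applied to the register; the outcome is automatically written on the communication cell (so it is revealed to the prover), and the next configuration is determined by the state, the scanned symbols and the outcome (deterministic transitions use the identity). In a communication state, $V$ writes on the cell a symbol determined by its state, the prover answers with a symbol, and $V$'s next state is determined by its state and the prover's symbol. A prover is an arbitrary (not necessarily computable) function giving its response from the input and the communication history so far. The computation may run forever. Acceptance (rejection) probability of $(P,V)$ on $x$ is the total probability of reaching an accepting (rejecting) state. $V$ is $s(n)$ space-bounded if it uses $O(s(n))$ work-tape cells on inputs of length $n$. **Class.** $L\in\mathsf{weak}\text{-}\mathsf{qAM}_1(1)$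 iff there are $(P,V)$ with $V$ using $O(1)$ space and $\epsilon<\frac12$ such that: for all $x\in L$, $(P,V)$ accepts $x$ with probability exactly $1$ (perfect completeness); for all $x\notin L$ and all provers $P^*$, $(P^*,V)$ accepts $x$ with probability at most $\epsilon$ (weak soundness). *)

(* Defs.v *)
From HB Require Import structures.
From mathcomp Require Import all_boot all_order all_algebra.
From mathcomp Require Import complex.
From mathcomp Require Import all_classical all_reals all_analysis.

Set Implicit Arguments.
Unset Strict Implicit.
Unset Printing Implicit Defensive.

Import Order.TTheory GRing.Theory Num.Theory.
Import numFieldNormedType.Exports.
Local Open Scope classical_set_scope.
Local Open Scope ring_scope.
Local Open Scope complex_scope.

Inductive move := MoveLeft | Stay | MoveRight.

(* Two-way infinite tape. [tleft] lists the cells to the left of the head,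
   nearest first.  Only cells the head has visited (or that carry the input)
   are stored; every other cell is blank. *)
Record tape (S : Type) := Tape { tleft : seq S; thead : S; tright : seq S }.

Definition tape_size (S : Type) (t : tape S) : nat :=
  (size (tleft t) + (size (tright t)).+1)%N.

Definition tape_write (S : Type) (s : S) (t : tape S) : tape S :=
  Tape (tleft t) s (tright t).

Definition tape_move (S : Type) (blank : S) (m : move) (t : tape S) : tape S :=
  match m with
  | Stay => t
  | MoveLeft =>
      Tape (behead (tleft t)) (head blank (tleft t)) (thead t :: tright t)
  | MoveRight =>
      Tape (thead t :: tleft t) (head blank (tright t)) (behead (tright t))
  end.

Record turing_machine (Sigma : finType) := TuringMachine {
  tm_state : finType;
  tm_symbol : finType;
  tm_blank : tm_symbol;
  tm_letter : Sigma -> tm_symbol;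
  tm_letter_inj : injective tm_letter;
  tm_letter_nblank : forall a, tm_letter a != tm_blank;
  tm_start : tm_state;
  tm_accept : tm_state;
  tm_reject : tm_state;
  tm_accept_neq_reject : tm_accept != tm_reject;
  tm_delta : tm_state -> tm_symbol -> tm_state * tm_symbol * move }.

Section TuringRecognizable.
Variables (Sigma : finType) (M : turing_machine Sigma).

Definition tm_config : Type := (tm_state M * tape (tm_symbol M))%type.

Definition tm_init (x : seq Sigma) : tm_config :=
  (tm_start M,
   if map (@tm_letter _ M) x is a :: s then Tape [::] a s
   else Tape [::] (tm_blank M) [::]).

Definition tm_step (c : tm_config) : tm_config :=
  if (c.1 == tm_accept M) || (c.1 == tm_reject M) then c
  else let: (q, s, m) := tm_delta c.1 (thead c.2) in
       (q, tape_move (tm_blank M) m (tape_write s c.2)).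

Definition tm_accepts (x : seq Sigma) : Prop :=
  exists t, (iter t tm_step (tm_init x)).1 = tm_accept M.

End TuringRecognizable.

Definition turing_recognizable (Sigma : finType) (L : set (seq Sigma)) : Prop :=
  exists M : turing_machine Sigma, forall x, L x <-> tm_accepts M x.

(* The operators are indexed by their outcome, i.e. by the symbol that the
   outcome writes on the communication cell; a superoperator with fewer outcomes
   than there are symbols has zero matrices at the unused ones.  As the entries
   are rational, the adjoint is the transpose. *)
Record superoperator (Gamma : finType) (d : nat) := Superoperator {
  kraus : Gamma -> 'M[rat]_d;
  kraus_complete : \sum_g (kraus g)^T *m kraus g = 1%:M }.

(* [Reset g] puts the register in its predefined state, with the single
   outcome [g]. *)
Inductive register_op (Gamma : finType) (d : nat) :=
  | Apply of superoperator Gamma d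
  | Reset of Gamma.

Inductive input_symbol (Sigma : Type) := LeftEnd | Letter of Sigma | RightEnd.
Arguments LeftEnd {Sigma}.
Arguments RightEnd {Sigma}.

Inductive state_kind := Reading | Communicating | Accepting | Rejecting.

Record verifier (Sigma : finType) := Verifier {
  v_state : finType;
  v_work : finType;
  v_blank : v_work;
  v_comm : finType;
  v_dim : nat;
  v_reg0 : 'cV[rat]_v_dim;
  v_reg0_unit : v_reg0^T *m v_reg0 = 1%:M;
  v_start : v_state;
  v_kind : v_state -> state_kind;
  v_op : v_state -> input_symbol Sigma -> v_work -> register_op v_comm v_dim;
  (* next state, symbol written on the work tape, moves of the input head and
     of the work head *)
  v_next : v_state -> input_symbol Sigma -> v_work -> v_comm ->
             v_state * v_work * move * move;
  v_send : v_state -> v_comm;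
  v_receive : v_state -> v_comm -> v_state }.

(* The history is the chronological list of all symbols written on the
   communication cell: outcomes, symbols sent by the verifier, and replies. *)
Definition prover (Sigma : finType) (V : verifier Sigma) : Type :=
  seq Sigma -> seq (v_comm V) -> v_comm V.

Definition input_at (Sigma : Type) (x : seq Sigma) (i : nat)
    : input_symbol Sigma :=
  if i is j.+1 then
    if ohead (drop j x) is Some a then Letter a else RightEnd
  else LeftEnd.

(* The cells of the input tape are 0 (left end symbol), 1, ..., n,
   n.+1 (right end symbol), and the head never leaves them. *)
Definition input_move (n : nat) (m : move) (i : nat) : nat :=
  match m with
  | MoveLeft => i.-1
  | Stay => i
  | MoveRight => minn i.+1 n.+1
  end.

Section Register.
Variables (R : realType) (Gamma : finType) (d : nat).

Definition sqnorm (psi : 'cV[R[i]]_d) : R := \sum_j Normc.normc (psi j 0) ^+ 2.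

Definition kraus_apply (E : superoperator Gamma d) (psi : 'cV[R[i]]_d)
    (g : Gamma) : 'cV[R[i]]_d :=
  map_mx ratr (kraus E g) *m psi.

Definition outcome_prob (op : register_op Gamma d) (psi : 'cV[R[i]]_d)
    (g : Gamma) : R :=
  match op with
  | Apply E => sqnorm (kraus_apply E psi g)
  | Reset g0 => (g == g0)%:R
  end.

Definition outcome_state (reg0 : 'cV[rat]_d) (op : register_op Gamma d)
    (psi : 'cV[R[i]]_d) (g : Gamma) : 'cV[R[i]]_d :=
  match op with
  | Apply E => (Num.sqrt (outcome_prob op psi g))^-1%:C *: kraus_apply E psi g
  | Reset _ => map_mx ratr reg0
  end.

End Register.

Section Run.
Variables (R : realType) (Sigma : finType) (V : verifier Sigma).
Variables (P : prover V) (x : seq Sigma).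

Record config := Config {
  c_state : v_state V;
  c_input : nat;
  c_work : tape (v_work V);
  c_reg : 'cV[R[i]]_(v_dim V);
  c_hist : seq (v_comm V) }.

Definition init_config : config :=
  {| c_state := v_start V;
     c_input := 0%N;
     c_work := Tape [::] (v_blank V) [::];
     c_reg := map_mx ratr (v_reg0 V);
     c_hist := [::] |}.

Definition current_op (c : config) : register_op (v_comm V) (v_dim V) :=
  v_op (c_state c) (input_at x (c_input c)) (thead (c_work c)).

Definition read_prob (c : config) (g : v_comm V) : R :=
  outcome_prob (current_op c) (c_reg c) g.

Definition read_step (c : config) (g : v_comm V) : config :=
  let: (q, w, mi, mw) :=
    v_next (c_state c) (input_at x (c_input c)) (thead (c_work c)) g in
  {| c_state := q;
     c_input := input_move (size x) mi (c_input c);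
     c_work := tape_move (v_blank V) mw (tape_write w (c_work c));
     c_reg := outcome_state (v_reg0 V) (current_op c) (c_reg c) g;
     c_hist := rcons (c_hist c) g |}.

Definition comm_step (c : config) : config :=
  let h := rcons (c_hist c) (v_send (c_state c)) in
  let r := P x h in
  {| c_state := v_receive (c_state c) r;
     c_input := c_input c;
     c_work := c_work c;
     c_reg := c_reg c;
     c_hist := rcons h r |}.

(* Probability of reaching an accepting state within [t] steps from [c]. *)
Fixpoint accept_within (t : nat) (c : config) : R :=
  match v_kind (c_state c), t with
  | Accepting, _ => 1
  | Rejecting, _ => 0
  | _, 0%N => 0
  | Reading, t'.+1 =>
      \sum_g read_prob c g * accept_within t' (read_step c g)
  | Communicating, t'.+1 => accept_within t' (comm_step c)
  end.

(* Reaching an accepting state is the increasing union over [t] of reaching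
   one within [t] steps. *)
Definition accept_prob : R :=
  limn (fun t => accept_within t init_config).

Inductive reachable : config -> Prop :=
  | reachable_init : reachable init_config
  | reachable_read c g : reachable c -> v_kind (c_state c) = Reading ->
      0 < read_prob c g -> reachable (read_step c g)
  | reachable_comm c : reachable c -> v_kind (c_state c) = Communicating ->
      reachable (comm_step c).

End Run.

(* The work tape starts with one cell and grows by one exactly when the head
   enters a new cell, so its size is the number of cells used so far. *)
Definition space_bounded (R : realType) (Sigma : finType) (V : verifier Sigma)
    (s : nat -> nat) : Prop :=
  exists C : nat, forall (P : prover V) (x : seq Sigma) (c : config R V),
    reachable P x c -> (tape_size (c_work c) <= C * s (size x))%N.

Definition weak_qAM1 (R : realType) (Sigma : finType) (s : nat -> nat)
    (L : set (seq Sigma)) : Prop :=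
  exists (V : verifier Sigma) (P : prover V) (eps : R),
    [/\ space_bounded R V s,
        eps < 2^-1,
        forall x, L x -> accept_prob R P x = 1
      & forall x, ~ L x -> forall P' : prover V, accept_prob R P' x <= eps].

(* Main.v *)
(* The verifier keeps an integer vector [(1, l, r, y)] in the amplitudes of its
   register, up to a scalar: [l] and [r] are the two halves of the tape of the
   Turing machine, read as numbers in a fixed base, so that pushing a symbol is a
   linear map.  A symbol is popped with the help of the prover, who counts out the
   quotient [y] in unary and then announces the remainder; the verifier projects
   on the difference, which is a nonzero integer if the claim is wrong, and
   rejects if it sees it.

   Every linear map is divided by the same large integer and completed to a
   superoperator by outcomes on which the verifier starts all over.  Accepting
   therefore has a tiny probability in each round, but a failed check has had at
   least a constant times that probability of rejection, because the difference is
   an integer.  On a valid history nothing ever rejects, so that repeated rounds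
   accept with probability 1. *)

Require Import Defs.
From mathcomp Require Import all_boot all_order all_algebra.
From mathcomp Require Import complex ring lra zify.
From mathcomp Require Import all_classical all_reals all_analysis.

Set Implicit Arguments.
Unset Strict Implicit.
Unset Printing Implicit Defensive.

Import Order.TTheory GRing.Theory Num.Theory.
Import numFieldNormedType.Exports.
Local Open Scope classical_set_scope.
Local Open Scope ring_scope.
Local Open Scope complex_scope.

(** * Registers and acceptance probabilities *)

Section Norms.
Variable R : realType.
Implicit Types (z : R[i]) (q : rat).

Lemma sqr_normc z : Normc.normc z ^+ 2 = complex.Re z ^+ 2 + complex.Im z ^+ 2.
Proof. by case: z => a b /=; rewrite sqr_sqrtr // addr_ge0 // sqr_ge0. Qed.

Lemma ratr_complex q : ratr q = (ratr q : R)%:C :> R[i].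
Proof. by rewrite -(fmorph_eq_rat (real_complex R \o ratr)). Qed.

Lemma Re_real_mul (a : R) z : complex.Re (a%:C * z) = a * complex.Re z.
Proof. by case: z => x y /=; rewrite mul0r subr0. Qed.

Lemma Im_real_mul (a : R) z : complex.Im (a%:C * z) = a * complex.Im z.
Proof. by case: z => x y /=; rewrite mul0r addr0. Qed.

Lemma Re_sum (I : finType) (F : I -> R[i]) :
  complex.Re (\sum_i F i) = \sum_i complex.Re (F i).
Proof. by apply: (big_morph (@complex.Re R)) => // -[a b] [c e]. Qed.

Lemma Im_sum (I : finType) (F : I -> R[i]) :
  complex.Im (\sum_i F i) = \sum_i complex.Im (F i).
Proof. by apply: (big_morph (@complex.Im R)) => // -[a b] [c e]. Qed.

Lemma sqr_normc_real (a : R) : Normc.normc a%:C ^+ 2 = a ^+ 2.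
Proof. by rewrite sqr_normc /= expr0n addr0. Qed.

Section Dim.
Variable d : nat.
Implicit Types psi : 'cV[R[i]]_d.

Lemma sqnorm_ge0 psi : 0 <= sqnorm psi.
Proof. by apply: sumr_ge0 => j _; rewrite sqr_ge0. Qed.

Lemma sqnormZ a psi : sqnorm (a *: psi) = Normc.normc a ^+ 2 * sqnorm psi.
Proof.
by rewrite /sqnorm mulr_sumr; apply: eq_bigr => j _; rewrite mxE Normc.normcM exprMn.
Qed.

Lemma coord_le_sqnorm psi j : Normc.normc (psi j 0) ^+ 2 <= sqnorm psi.
Proof.
rewrite /sqnorm (bigD1 j) //= lerDl; apply: sumr_ge0 => k _; exact: sqr_ge0.
Qed.

Lemma sqnormE psi : sqnorm psi =
  ((map_mx (@complex.Re R) psi)^T *m map_mx (@complex.Re R) psi) 0 0 +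
  ((map_mx (@complex.Im R) psi)^T *m map_mx (@complex.Im R) psi) 0 0.
Proof.
rewrite !mxE -big_split; apply: eq_bigr => j _.
by rewrite !mxE sqr_normc !expr2.
Qed.

Lemma map_Re_mul (K : 'M[rat]_d) psi :
  map_mx (@complex.Re R) (map_mx ratr K *m psi) =
  map_mx ratr K *m map_mx (@complex.Re R) psi.
Proof.
apply/matrixP => i j; rewrite !mxE Re_sum.
by apply: eq_bigr => k _; rewrite !mxE ratr_complex Re_real_mul.
Qed.

Lemma map_Im_mul (K : 'M[rat]_d) psi :
  map_mx (@complex.Im R) (map_mx ratr K *m psi) =
  map_mx ratr K *m map_mx (@complex.Im R) psi.
Proof.
apply/matrixP => i j; rewrite !mxE Im_sum.
by apply: eq_bigr => k _; rewrite !mxE ratr_complex Im_real_mul.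
Qed.

(** The Kraus matrices are real, so they act separately on real and imaginary parts; on each part
    the completeness relation collapses a real quadratic form. *)
Lemma sum_kraus (Gamma : finType) (E : superoperator Gamma d) psi :
  \sum_g sqnorm (kraus_apply E psi g) = sqnorm psi.
Proof.
have quad (u : 'cV[R]_d) :
    \sum_g ((map_mx ratr (kraus E g) *m u)^T *m (map_mx ratr (kraus E g) *m u)) 0 0
    = (u^T *m u) 0 0.
  rewrite -[in RHS](mulmx1 u^T) -(map_mx1 (ratr : rat -> R)) -(kraus_complete E).
  rewrite map_mx_sum mulmx_sumr mulmx_suml summxE; apply: eq_bigr => g _.
  by rewrite map_mxM -map_trmx trmx_mul !mulmxA.
rewrite sqnormE -!quad -big_split; apply: eq_bigr => g _.
by rewrite sqnormE /kraus_apply map_Re_mul map_Im_mul.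
Qed.

Variables (Gamma : finType) (reg0 : 'cV[rat]_d).
Implicit Types op : register_op Gamma d.

Lemma outcome_prob_ge0 op psi g : 0 <= outcome_prob op psi g.
Proof. by case: op => [E|g0] /=; [exact: sqnorm_ge0 | rewrite ler0n]. Qed.

Lemma sum_outcome_prob_le1 op psi :
  sqnorm psi <= 1 -> \sum_g outcome_prob op psi g <= 1.
Proof.
case: op => [E|g0] psi1 /=; first by rewrite sum_kraus.
by rewrite -natr_sum (bigD1 g0) //= eqxx big1 // => g /negbTE ->.
Qed.

(** Normalization cancels against the probability. At probability 0 every coordinate vanishes, so
    amplitudes can be followed without side conditions. *)
Lemma normalized_coord (E : superoperator Gamma d) psi g j :
  outcome_prob (Apply E) psi g *
    Normc.normc (outcome_state reg0 (Apply E) psi g j 0) ^+ 2 =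
  Normc.normc (kraus_apply E psi g j 0) ^+ 2.
Proof.
rewrite /= mxE Normc.normcM exprMn sqr_normc_real mulrA.
set p := sqnorm _.
have [p0|p0] := eqVneq p 0.
  rewrite p0 !mul0r; apply/eqP; rewrite eq_sym eq_le sqr_ge0 andbT -p0.
  exact: coord_le_sqnorm.
by rewrite exprVn sqr_sqrtr ?sqnorm_ge0 // divff // mul1r.
Qed.

Lemma sqnorm_outcome_state_Apply (E : superoperator Gamma d) psi g :
  sqnorm (kraus_apply E psi g) != 0 ->
  sqnorm (outcome_state reg0 (Apply E) psi g) = 1.
Proof.
move=> p0; rewrite /= sqnormZ sqr_normc_real exprVn sqr_sqrtr ?sqnorm_ge0 //.
by rewrite mulVf.
Qed.

Lemma sqnorm_map_ratr : reg0^T *m reg0 = 1%:M ->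
  sqnorm (map_mx ratr reg0 : 'cV[R[i]]_d) = 1.
Proof.
move=> /matrixP/(_ 0 0); rewrite !mxE => /(congr1 (ratr : rat -> R)).
rewrite rmorph_sum rmorph1 => <-; apply: eq_bigr => j _.
by rewrite !mxE ratr_complex sqr_normc_real rmorphM expr2.
Qed.

(** Only an inequality: an outcome of probability 0 leaves the zero vector, since the inverse of 0
    is 0. *)
Lemma sqnorm_outcome_state op psi g : reg0^T *m reg0 = 1%:M ->
  sqnorm (outcome_state reg0 op psi g) <= 1.
Proof.
move=> u0; case: op => [E|g0]; last by rewrite /= sqnorm_map_ratr.
have [p0|p0] := eqVneq (sqnorm (kraus_apply E psi g)) 0.
  by rewrite /= sqnormZ p0 mulr0.
by rewrite sqnorm_outcome_state_Apply.
Qed.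

End Dim.
End Norms.

(** * Acceptance probabilities as limits of monotone sequences *)

Section AcceptWithin.
Variables (R : realType) (Sigma : finType) (V : verifier Sigma).
Variables (P : prover V) (x : seq Sigma).
Implicit Types c : config R V.

Lemma accept_within_ge0 t c : 0 <= accept_within P x t c.
Proof.
elim: t c => [|t IH] c /=; case: v_kind => //.
by apply: sumr_ge0 => g _; rewrite mulr_ge0 ?outcome_prob_ge0.
Qed.

Lemma accept_within_le1 t c : sqnorm (c_reg c) <= 1 -> accept_within P x t c <= 1.
Proof.
elim: t c => [|t IH] c c1 /=; case: v_kind => //; last exact: IH.
apply: le_trans (sum_outcome_prob_le1 (current_op x c) c1).
apply: ler_sum => g _; rewrite -[leRHS]mulr1 ler_wpM2l ?outcome_prob_ge0 //.
apply: IH; rewrite /read_step; case: v_next => [[[q w] mi] mw] /=.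
exact/sqnorm_outcome_state/v_reg0_unit.
Qed.

Lemma accept_within_S t c : accept_within P x t c <= accept_within P x t.+1 c.
Proof.
elim: t c => [|t IH] c.
  by have := accept_within_ge0 1 c; rewrite /=; case: v_kind => //.
rewrite [leRHS]/= [leLHS]/=; case: v_kind => //.
by apply: ler_sum => g _; rewrite ler_wpM2l ?outcome_prob_ge0 //; exact: IH.
Qed.

Lemma accept_within_nondecreasing c :
  nondecreasing_seq (fun t => accept_within P x t c).
Proof. by apply/nondecreasing_seqP => t; exact: accept_within_S. Qed.

Lemma accept_prob_le (e : R) :
  (forall t, accept_within P x t (init_config R V) <= e) -> accept_prob R P x <= e.
Proof.
move=> H; apply: limr_le; last by near=> t; exact: H.
apply: nondecreasing_is_cvgn; first exact: accept_within_nondecreasing.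
by exists e => _ [t _ <-].
Unshelve. all: by end_near. Qed.

(** Meant for repeated rounds of at most [T] steps that each accept with probability at least [eta]:
    the chance that [k] rounds fail tends to 0. *)
Lemma accept_prob_eq1 (T : nat) (eta : R) : 0 < eta <= 1 ->
  (forall k s, (k * T <= s)%N ->
     1 - (1 - eta) ^+ k <= accept_within P x s (init_config R V)) ->
  accept_prob R P x = 1.
Proof.
move=> /andP[eta0 eta1] H; apply/eqP; rewrite eq_le; apply/andP; split.
  apply: accept_prob_le => t; apply: accept_within_le1.
  by rewrite sqnorm_map_ratr // v_reg0_unit.
have cvg1 : (fun k => 1 - (1 - eta) ^+ k) @ \oo --> (1 : R).
  rewrite -[X in _ --> X]subr0; apply: cvgB; first exact: cvg_cst.
  by apply: cvg_expr; rewrite ger0_norm; lra.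
apply: cvgr_to_le cvg1 _; near=> k.
apply: le_trans (H k (k * T)%N (leqnn _)) _.
apply: nondecreasing_cvgn_le; first exact: accept_within_nondecreasing.
apply: nondecreasing_is_cvgn; first exact: accept_within_nondecreasing.
exists 1 => _ [t _ <-]; apply: accept_within_le1.
by rewrite sqnorm_map_ratr // v_reg0_unit.
Unshelve. all: by end_near. Qed.

End AcceptWithin.

(** * Completing integer matrices to a superoperator *)

Section Completion.
Variables (I : finType) (d : nat).
Implicit Types (G : I -> 'M[int]_d) (S : 'M[int]_d).

Definition skew (a b : 'I_d) : 'M[int]_d := delta_mx a b - delta_mx b a.

Lemma delta_mx_sandwich S (a b c e : 'I_d) :
  delta_mx a b *m S *m delta_mx c e = S b c *: delta_mx a e.
Proof.
apply/matrixP => i j; rewrite !mxE (bigD1 c) //= big1 ?addr0; last first.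
  by move=> k kc; rewrite [delta_mx c e k j]mxE (negbTE kc) mulr0.
rewrite mxE (bigD1 b) //= big1 ?addr0; last first.
  by move=> k kb; rewrite mxE (negbTE kb) andbF mul0r.
by rewrite !mxE !eqxx /= andbT; case: (i == a); case: (j == e);
  rewrite /= ?mul1r ?mul0r ?mulr1 ?mulr0.
Qed.

Lemma sum_diag_delta : \sum_(a < d) delta_mx a a = 1%:M :> 'M[int]_d.
Proof.
apply/matrixP => i j; rewrite summxE (bigD1 i) //= big1 ?addr0.
  by rewrite !mxE eqxx eq_sym.
by move=> k ki; rewrite mxE eq_sym (negbTE ki).
Qed.

(* Summed over all rows of a matrix, this is Lagrange's identity
   [|u|^2 |v|^2 - (u.v)^2 = \sum_(a < b) (u_a v_b - u_b v_a)^2]. *)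
Lemma sum_skew S : S^T = S ->
  \sum_a \sum_b (skew a b)^T *m S *m skew a b = (2 * \tr S)%:M - 2 *: S.
Proof.
move=> symS.
have E a b : (skew a b)^T *m S *m skew a b =
   S a a *: delta_mx b b + S b b *: delta_mx a a
   - (S a b *: delta_mx b a + S b a *: delta_mx a b).
  have -> : (skew a b)^T = delta_mx b a - delta_mx a b.
    by apply/matrixP => i j; rewrite !mxE andbC [(j == b) && _]andbC.
  rewrite /skew !mulmxBl !mulmxBr !delta_mx_sandwich.
  by rewrite opprB addrACA opprD.
under eq_bigr => a _ do under eq_bigr => b _ do rewrite E.
rewrite (eq_bigr (fun a => (S a a)%:M + \tr S *: delta_mx a a -
    (\sum_b S a b *: delta_mx b a + \sum_b S b a *: delta_mx a b))); last first.
  move=> a _; rewrite sumrB !big_split /= -scaler_sumr sum_diag_delta.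
  by rewrite -scaler_suml scalemx1.
rewrite sumrB !big_split /= -scaler_sumr sum_diag_delta scalemx1 -raddf_sum /=.
rewrite -raddfD /= -mulr2n mulr_natl; congr (_ - _).
rewrite scaler_nat mulr2n; congr (_ + _).
  rewrite [RHS]matrix_sum_delta exchange_big /=.
  by apply: eq_bigr => a _; apply: eq_bigr => b _; rewrite -[S in LHS]symS mxE.
rewrite [RHS]matrix_sum_delta.
by apply: eq_bigr => a _; apply: eq_bigr => b _; rewrite -[S in LHS]symS mxE.
Qed.

(** Write [S] for the sum of all [(G i)^T *m G i] and [t] for its trace. The skew products
    contribute [2 t I - 2 S]; the second copy of each [G i], together with the original, cancels
    [- 2 S]; identities padded with zeros fill [2 t] up to [C ^ 2]. The index set does not depend on
    [G], so one alphabet serves all instructions. *)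
Definition completion_index (C : nat) : finType :=
  (I + (I * ('I_d * 'I_d)) + 'I_(C ^ 2)%N)%type.

Definition gram_trace G : nat := \sum_i `|\tr ((G i)^T *m G i)|%N.

Definition completion_mx G C (k : completion_index C) : 'M[int]_d :=
  match k with
  | inl (inl i) => G i
  | inl (inr p) => G p.1 *m skew p.2.1 p.2.2
  | inr k => if (k < C ^ 2 - 2 * gram_trace G)%N then 1%:M else 0
  end.

Lemma gram_trace_sum G :
  (gram_trace G)%:R = \sum_i \tr ((G i)^T *m G i).
Proof.
rewrite /gram_trace natr_sum; apply: eq_bigr => i _.
rewrite natz gez0_abs //; apply: sumr_ge0 => j _; rewrite mxE.
by apply: sumr_ge0 => k _; rewrite mxE -expr2 sqr_ge0.
Qed.

Lemma sum_completion G C : (2 * gram_trace G <= C ^ 2)%N ->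
  \sum_i (G i)^T *m G i +
  \sum_k (completion_mx G (k : completion_index C))^T *m completion_mx G k = (C ^ 2)%:R%:M.
Proof.
move=> le_tr; rewrite !big_sumType /= addrA addrA.
have -> : \sum_(p : I * ('I_d * 'I_d))
     (G p.1 *m skew p.2.1 p.2.2)^T *m (G p.1 *m skew p.2.1 p.2.2) =
   (2 * gram_trace G)%:R%:M - 2 *: \sum_i (G i)^T *m G i.
  rewrite -(pair_bigA _ (fun i p => (G i *m skew p.1 p.2)^T *m (G i *m skew p.1 p.2))) /=.
  rewrite scaler_sumr natrM gram_trace_sum mulr_sumr raddf_sum -sumrB.
  apply: eq_bigr => i _.
  rewrite -sum_skew; last by rewrite trmx_mul trmxK.
  rewrite pair_bigA; apply: eq_bigr => p _.
  by rewrite trmx_mul !mulmxA.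
have -> : \sum_(k < C ^ 2) (if (k < C ^ 2 - 2 * gram_trace G)%N then 1%:M else 0)^T *m
    (if (k < C ^ 2 - 2 * gram_trace G)%N then 1%:M else 0)
   = (C ^ 2)%:R%:M - (2 * gram_trace G)%:R%:M :> 'M[int]_d.
  rewrite (eq_bigr (fun k : 'I_(C ^ 2) =>
    if (k < C ^ 2 - 2 * gram_trace G)%N then 1%:M else 0)); last first.
    by move=> k _; case: ifP => _; rewrite ?trmx1 ?mulmx1 ?mulmx0.
  rewrite -big_mkcond /= (big_ord_narrow (leq_subr _ _)) sumr_const card_ord.
  by rewrite -raddfMn /= natrB // raddfB.
rewrite scaler_nat mulr2n.
set S := \sum_i _; set X := _%:M; set Y := (_ %:M).
by apply/matrixP=> a b; rewrite !mxE; ring.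
Qed.

Definition scaled (C : nat) (A : 'M[int]_d) : 'M[rat]_d := C%:R^-1 *: map_mx intr A.

Lemma scaled_gram C A : (scaled C A)^T *m scaled C A =
  (C ^ 2)%:R^-1 *: map_mx intr (A^T *m A).
Proof.
have -> : (scaled C A)^T = C%:R^-1 *: map_mx intr A^T.
  by apply/matrixP => i j; rewrite !mxE.
rewrite /scaled -scalemxAl -scalemxAr scalerA -map_mxM.
by rewrite -invfM -natrM mulnn.
Qed.

Lemma sum_scaled_completion G C : (0 < C)%N -> (2 * gram_trace G <= C ^ 2)%N ->
  \sum_i (scaled C (G i))^T *m scaled C (G i) +
  \sum_(k : completion_index C)
     (scaled C (completion_mx G k))^T *m scaled C (completion_mx G k) = 1%:M.
Proof.
move=> C0 le_tr.
under eq_bigr do rewrite scaled_gram; under [X in _ + X]eq_bigr do rewrite scaled_gram.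
rewrite -!scaler_sumr -scalerDr -!map_mx_sum -map_mxD sum_completion //.
rewrite map_scalar_mx rmorph_nat scale_scalar_mx mulVf //.
by rewrite pnatr_eq0 -lt0n expn_gt0 C0.
Qed.
End Completion.

(** * From checked linear machines to verifiers *)

(* [Step q m A B] requires that the matrix [B] kills the current vector; the
   vector is then multiplied by [A]. *)
Inductive instr (Q : Type) (d : nat) :=
  | Halt of bool
  | Step of Q & move & 'M[int]_d & 'M[int]_d.
Arguments Halt {Q d}.

(* A finite automaton that is driven by the actions of an untrusted prover and
   acts linearly on an integer vector whose coordinate 0 is constantly 1. *)
Record checked_machine (Sigma : finType) := CheckedMachine {
  cm_state : finType;
  cm_action : finType;
  cm_dim : nat;
  cm_start : cm_state;
  cm_instr : cm_state -> cm_action -> input_symbol Sigma -> instr cm_state cm_dim.+1;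
  cm_unit : forall q a s,
    if cm_instr q a s is Step _ _ A _ then forall j, A 0 j = (j == 0)%:R else True }.

Lemma mulmx_fst (T : pzSemiRingType) d (F : 'M[T]_d.+1) (v : 'cV[T]_d.+1) :
  (forall j, F 0 j = (j == 0)%:R) -> (F *m v) 0 0 = v 0 0.
Proof.
move=> F0; rewrite mxE (bigD1 0) //= big1 ?addr0 => [|j j0]; rewrite F0 ?mul1r //.
by rewrite (negbTE j0) mul0r.
Qed.

(** * Real inequalities for a single step *)

Section Arithmetic.
Variable F : realFieldType.
Implicit Types n e p f g r w y z : F.

Lemma addBB y z n : y + (z + n) - y - z = n.
Proof. ring. Qed.

(** In the upper bounds, [n] is the squared norm of the register, [p] and [f] are the probabilities
    of carrying out and of rejecting, [g] is the contribution of carrying out, and [y] is [rate]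
    times the weight. The remaining mass restarts and is worth at most one third. *)
Lemma halt_bound n p f y (b : bool) : n <= 1 -> 0 <= p -> 0 <= f -> p = y ->
  p * b%:R + 3^-1 * (n - p - f) <= 3^-1 + y.
Proof. by case: b => /= *; lra. Qed.

Lemma halt_fail_bound n p f : n <= 1 -> 0 <= p -> 0 <= f ->
  p * false%:R + 3^-1 * (n - p - f) <= 3^-1.
Proof. by move=> *; rewrite /=; lra. Qed.

Lemma step_bound n p f g : n <= 1 -> 0 <= f -> g <= p * 3^-1 ->
  g + 3^-1 * (n - p - f) <= 3^-1.
Proof. by move=> *; lra. Qed.

Lemma step_gain_bound n p f g y z : n <= 1 -> 0 <= f ->
  g <= p * 3^-1 + z -> z <= 4^-1 * y -> 0 <= y ->
  g + 3^-1 * (n - p - f) <= 3^-1 + y.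
Proof. by move=> *; lra. Qed.

(** A gain of at most [y / 4] is outweighed by one third of the rejected mass [f], which is at least
    [y]. *)
Lemma step_fail_bound n p f g y z : n <= 1 ->
  g <= p * 3^-1 + z -> z <= 4^-1 * y -> 0 <= y -> y <= f ->
  g + 3^-1 * (n - p - f) <= 3^-1.
Proof. by move=> *; lra. Qed.

Lemma halt_gain e y z : e <= 1 -> z <= y ->
  e + (1 - e) * z <= y + e * (1 - y).
Proof. by move=> *; nra. Qed.

Lemma step_gain e p g r w y : p * (e + (1 - e) * (r * w)) <= p * g -> p * w = y ->
  e + (1 - e) * (r * y) <= p * g + e * (1 - p - 0).
Proof. by move=> le_pg <-; lra. Qed.

End Arithmetic.

Section Verifier.
Variables (Sigma : finType) (M : checked_machine Sigma).
Local Notation Q := (cm_state M).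
Local Notation A := (cm_action M).
Local Notation d := (cm_dim M).+1.

Fixpoint cm_accepts (x : seq Sigma) (s : seq A) (q : Q) (i : nat) (v : 'cV[int]_d)
    : Prop :=
  if s is a :: s' then
    match cm_instr q a (input_at x i) with
    | Halt b => b
    | Step q' m F B =>
        B *m v = 0 /\ cm_accepts x s' q' (input_move (size x) m i) (F *m v)
    end
  else False.

(* [true] indexes the operator that carries out the instruction, [false] the
   one that rejects. *)
Definition instr_mx (I : instr Q d) (b : bool) : 'M[int]_d :=
  match I with
  | Halt _ => if b then delta_mx 0 0 else 0
  | Step _ _ F B => if b then F else B
  end.

Definition instr_cost q a s : nat := (2 * gram_trace (instr_mx (@cm_instr _ M q a s)))%N.

(** One scale for all instructions makes every step shrink the weight by the same factor. The added
    2 makes [rate] at most one quarter. *)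
Definition scale : nat :=
  (\sum_q \sum_a (instr_cost q a LeftEnd + instr_cost q a RightEnd +
     \sum_l instr_cost q a (Letter l))).+2.

Lemma instr_cost_le q a s : (instr_cost q a s <= scale ^ 2)%N.
Proof.
apply: (@leq_trans scale); last by rewrite leq_pmulr.
apply: ltnW; apply: ltnW; rewrite 2!ltnS (bigD1 q) //= (bigD1 a) //=.
case: s => [|l|]; [by lia| | by lia].
by rewrite (bigD1 l) //=; lia.
Qed.

Local Notation K := (completion_index bool d scale).
(** Replies and outcomes share one alphabet. [restart] is the outcome of a reset, so the history
    shows where a round begins; [main true] is also the symbol by which the verifier asks for an
    action. *)
Definition symbol : finType := (option A + (bool + K))%type.
Local Notation restart := (inl None).
Local Notation act a := (inl (Some a)).
Local Notation main b := (inr (inl b)).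

Definition instr_kraus (I : instr Q d) (g : symbol) : 'M[rat]_d :=
  match g with
  | inr (inl b) => scaled scale (instr_mx I b)
  | inr (inr k) => scaled scale (completion_mx (instr_mx I) k)
  | inl _ => 0
  end.

Lemma instr_kraus_complete q a s :
  \sum_g (instr_kraus (cm_instr q a s) g)^T *m instr_kraus (cm_instr q a s) g = 1%:M.
Proof.
rewrite big_sumType big1 => [|i _]; last by rewrite mulmx0.
rewrite big_sumType /= add0r.
exact/sum_scaled_completion/instr_cost_le.
Qed.

Definition instr_op q a s : superoperator symbol d :=
  Superoperator (instr_kraus_complete q a s).

Definition vstate : finType := ((unit + bool) + (Q + Q * A))%type.
Local Notation wind := (inl (inl tt)).
Local Notation halted b := (inl (inr b)).
Local Notation ask q := (inr (inl q)).
Local Notation exec q a := (inr (inr (q, a))).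

Lemma reg0_unit : (delta_mx 0 0 : 'cV[rat]_d)^T *m delta_mx 0 0 = 1%:M.
Proof.
rewrite trmx_delta mul_delta_mx; apply/matrixP => i j.
by rewrite !mxE !ord1.
Qed.

(* Every outcome other than [main _] makes the verifier abandon the round:
   [wind] resets the register and takes the input head to the right end. *)
Definition cm_verifier : verifier Sigma := {|
  v_state := vstate;
  v_work := unit;
  v_blank := tt;
  v_comm := symbol;
  v_dim := d;
  v_reg0 := delta_mx 0 0;
  v_reg0_unit := reg0_unit;
  v_start := wind;
  v_kind := fun q => match q with
    | inl (inl _) => Reading
    | inl (inr b) => if b then Accepting else Rejecting
    | inr (inl _) => Communicating
    | inr (inr _) => Reading
    end;
  v_op := fun q s _ => match q with
    | inr (inr (q, a)) => Apply (instr_op q a s)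
    | _ => Reset _ restart
    end;
  v_next := fun q s _ g => match q with
    | inr (inr (q, a)) => match g with
        | inr (inl true) => match cm_instr q a s with
            | Halt b => (halted b, tt, Stay, Stay)
            | Step q' m _ _ => (ask q', tt, m, Stay)
            end
        | inr (inl false) => (halted false, tt, Stay, Stay)
        | _ => (wind, tt, Stay, Stay)
        end
    | _ => if s is RightEnd then (ask (cm_start M), tt, MoveLeft, Stay)
           else (wind, tt, MoveRight, Stay)
    end;
  v_send := fun _ => main true;
  v_receive := fun q g => match q, g with
    | inr (inl q), inl (Some a) => exec q a
    | _, _ => halted false
    end |}.

Variable R : realType.
Local Notation V := cm_verifier.
Local Notation config := (config R V).
Implicit Types (P : prover V) (x : seq Sigma) (c : config) (psi : 'cV[R[i]]_d).

Lemma reachable_work P x c : reachable P x c -> c_work c = Tape [::] tt [::].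
Proof.
elim=> // {}c g _ Hw _ _; rewrite /read_step /= Hw.
case: (c_state c) => [[?|?]|[?|[q a]]] /=; try by case: input_at.
by case: g => [?|[[]|?]] //=; case: cm_instr.
Qed.

Lemma space_bounded_cm_verifier : space_bounded R V (fun=> 1%N).
Proof. by exists 1%N => P x c /reachable_work ->. Qed.

(** * Evolution of the weight in one step *)

Definition rate : R := (scale%:R ^+ 2)^-1.
(** The tracked integer vector has coordinate 0 equal to 1, so this is the squared modulus of the
    scalar in front of it. *)
Definition weight psi : R := Normc.normc (psi 0 0) ^+ 2.
Definition cmul (F : 'M[int]_d) psi : 'cV[R[i]]_d := map_mx intr F *m psi.

Lemma rate_gt0 : 0 < rate.
Proof. by rewrite invr_gt0 exprn_gt0. Qed.

Lemma rate_le : rate <= 4^-1.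
Proof.
rewrite lef_pV2 ?posrE ?exprn_gt0 // -natrX ler_nat.
by rewrite (leq_exp2r 2 scale (_ : 0 < 2)%N).
Qed.

Lemma rate_lt1 : rate < 1.
Proof. by apply: le_lt_trans rate_le _; rewrite invf_lt1 // ltr1n. Qed.

Lemma kraus_apply_main q a s psi b : kraus_apply (instr_op q a s) psi (main b) =
  (scale%:R^-1)%:C *: cmul (instr_mx (cm_instr q a s) b) psi.
Proof.
rewrite /kraus_apply /= /cmul scalemxAl; congr (_ *m _).
apply/matrixP => i j; rewrite !mxE rmorphM /= ratr_int.
by congr (_ * _); rewrite ratr_complex; rewrite fmorphV rmorph_nat.
Qed.

Lemma outcome_prob_main q a s psi b :
  outcome_prob (Apply (instr_op q a s)) psi (main b) =
  rate * sqnorm (cmul (instr_mx (cm_instr q a s) b) psi).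
Proof. by rewrite /= kraus_apply_main sqnormZ sqr_normc_real exprVn. Qed.

Lemma outcome_state_main q a s psi : exists z,
  outcome_state (v_reg0 V) (Apply (instr_op q a s)) psi (main true) =
  z *: cmul (instr_mx (cm_instr q a s) true) psi.
Proof. by eexists; rewrite /outcome_state kraus_apply_main scalerA. Qed.

Lemma cm_step_fst (q : Q) (a : A) s q' m F B : cm_instr q a s = Step q' m F B ->
  forall j, F 0 j = (j == 0)%:R.
Proof. by move=> E; have := @cm_unit _ M q a s; rewrite E. Qed.

Lemma cmul_fst (F : 'M[int]_d) psi : (forall j, F 0 j = (j == 0)%:R) ->
  cmul F psi 0 0 = psi 0 0.
Proof.
by move=> F0; apply: mulmx_fst => j; rewrite mxE F0 rmorph_nat.
Qed.

(** Row 0 of [F] preserves coordinate 0, so only the division by [scale] changes the unnormalized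
    weight. *)
Lemma weight_step q a s q' m F B psi : cm_instr q a s = Step q' m F B ->
  outcome_prob (Apply (instr_op q a s)) psi (main true) *
    weight (outcome_state (v_reg0 V) (Apply (instr_op q a s)) psi (main true)) =
  rate * weight psi.
Proof.
move=> E; rewrite /weight normalized_coord kraus_apply_main mxE Normc.normcM exprMn.
by rewrite sqr_normc_real exprVn E (cmul_fst _ (cm_step_fst E)).
Qed.

(** The halting operator projects onto coordinate 0, so its probability reads off the weight. *)
Lemma prob_halt q a s b psi : cm_instr q a s = Halt b ->
  outcome_prob (Apply (instr_op q a s)) psi (main true) = rate * weight psi.
Proof.
move=> E; rewrite outcome_prob_main E /=; congr (_ * _).
have -> : cmul (delta_mx 0 0) psi = psi 0 0 *: delta_mx 0 0.
  apply/matrixP => i j; rewrite ord1 !mxE (bigD1 0) //= big1 => [|k k0].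
    by rewrite !mxE addr0 mulrC; congr (_ * _); case: (_ && _).
  by rewrite !mxE (negbTE k0) andbF mul0r.
rewrite sqnormZ /sqnorm (bigD1 0) //= big1 => [|k k0].
  by rewrite !mxE !eqxx Normc.normc1 expr1n addr0 mulr1.
by rewrite mxE (negbTE k0) Normc.normc0 expr0n.
Qed.

Lemma accept_within_halted P x t c b : c_state c = halted b ->
  accept_within P x t c = b%:R.
Proof. by case: t => [|t] /= ->; case: b. Qed.

Definition exec_prob x c q a (g : symbol) : R :=
  outcome_prob (Apply (instr_op q a (input_at x (c_input c)))) (c_reg c) g.

(** [main true] continues, [main false] rejects and contributes nothing, and all other outcomes
    return to [wind] with the input head in place. *)
Lemma accept_within_exec P x t c q a : c_state c = exec q a ->
  let p := exec_prob x c q a in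
  (forall g, (g != main true) && (g != main false) ->
     c_state (read_step x c g) = wind /\ c_input (read_step x c g) = c_input c) /\
  accept_within P x t.+1 c =
    p (main true) * accept_within P x t (read_step x c (main true)) +
    \sum_(g | (g != main true) && (g != main false))
      p g * accept_within P x t (read_step x c g) /\
  \sum_(g | (g != main true) && (g != main false)) p g =
    sqnorm (c_reg c) - p (main true) - p (main false).
Proof.
move=> Ec p; split; [|split].
- by rewrite /read_step Ec /= => - [u | [[] | k]].
- rewrite /= Ec /= (bigD1 (main true)) //= (bigD1 (main false)) //=.
  rewrite (@accept_within_halted P x t (read_step x c (main false)) false); last first.
    by rewrite /read_step Ec.
  by rewrite mulr0 add0r /p /exec_prob /read_prob /current_op Ec.
- rewrite -(sum_kraus (instr_op q a (input_at x (c_input c)))).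
  rewrite [in RHS](bigD1 (main true)) //=.
  rewrite [\sum_(g | g != main true) _](bigD1 (main false)) //= /p /exec_prob /=.
  by rewrite addBB.
Qed.

Lemma sqnorm_read_step x c g : sqnorm (c_reg (read_step x c g)) <= 1.
Proof.
rewrite /read_step; case: v_next => [[[q w] mi] mw] /=.
exact/sqnorm_outcome_state/reg0_unit.
Qed.

Lemma accept_within_exec_le P x t c q a e : c_state c = exec q a ->
  (forall c', c_state c' = wind -> c_input c' = c_input c ->
     sqnorm (c_reg c') <= 1 -> accept_within P x t c' <= e) ->
  accept_within P x t.+1 c <=
    exec_prob x c q a (main true) * accept_within P x t (read_step x c (main true)) +
    e * (sqnorm (c_reg c) - exec_prob x c q a (main true) - exec_prob x c q a (main false)).
Proof.
move=> Ec wind_le; have [Hg [E1 E2]] := accept_within_exec P x t Ec.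
rewrite E1 -{}E2 {E1}.
rewrite lerD2l mulr_sumr; apply: ler_sum => g /Hg [sg ig].
by rewrite mulrC ler_wpM2r ?outcome_prob_ge0 // wind_le // sqnorm_read_step.
Qed.

Lemma accept_within_exec_ge P x t c q a e : c_state c = exec q a ->
  (forall c', c_state c' = wind -> c_input c' = c_input c ->
     e <= accept_within P x t c') ->
    exec_prob x c q a (main true) * accept_within P x t (read_step x c (main true)) +
    e * (sqnorm (c_reg c) - exec_prob x c q a (main true) - exec_prob x c q a (main false)) <=
  accept_within P x t.+1 c.
Proof.
move=> Ec wind_le; have [Hg [E1 E2]] := accept_within_exec P x t Ec.
rewrite E1 -{}E2 {E1}.
rewrite lerD2l mulr_sumr; apply: ler_sum => g /Hg [sg ig].
by rewrite mulrC ler_wpM2l ?outcome_prob_ge0 // wind_le.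
Qed.

Lemma accept_within_wind P x t c : c_state c = wind ->
  accept_within P x t.+1 c = accept_within P x t (read_step x c restart).
Proof.
move=> Ec; rewrite /= Ec /= (bigD1 restart) //= big1 ?addr0.
  by rewrite /read_prob /current_op Ec /= ?eqxx mul1r.
by move=> g /negbTE ng; rewrite /read_prob /current_op Ec /= ng mul0r.
Qed.

Lemma read_step_exec x c q a : c_state c = exec q a ->
  let s := input_at x (c_input c) in
  let c' := read_step x c (main true) in
  [/\ c_state c' = match cm_instr q a s with
        | Halt b => halted b | Step q' _ _ _ => ask q' end,
      c_input c' = match cm_instr q a s with
        | Halt b => c_input c | Step _ m _ _ => input_move (size x) m (c_input c) end,
      c_reg c' = outcome_state (v_reg0 V) (Apply (instr_op q a s)) (c_reg c) (main true)
    & c_hist c' = rcons (c_hist c) (main true)].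
Proof.
by move=> Ec s c'; rewrite /c' /read_step /current_op Ec /= -/s; case: cm_instr.
Qed.

Lemma read_step_wind x c : c_state c = wind -> (c_input c <= size x)%N ->
  let c' := read_step x c restart in
  [/\ c_state c' = wind, c_input c' = (c_input c).+1 & c_hist c' = rcons (c_hist c) restart].
Proof.
move=> Ec ix c'; rewrite /c' /read_step Ec /=; case: (c_input c) ix => [|i] ix /=.
  by split=> //; lia.
(* Cell [i.+1] with [i < size x] holds a letter, so the right end is not reached yet. *)
case E: (drop i x) => [|b s] /=; first by move: (congr1 size E); rewrite size_drop /=; lia.
by split=> //; lia.
Qed.

Lemma read_step_wind_end x c : c_state c = wind -> c_input c = (size x).+1 ->
  let c' := read_step x c restart in
  [/\ c_state c' = ask (cm_start M), c_input c' = size x,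
      c_reg c' = map_mx ratr (v_reg0 V) & c_hist c' = rcons (c_hist c) restart].
Proof.
by move=> Ec ix c'; rewrite /c' /read_step /current_op Ec ix /= drop_size.
Qed.

Lemma input_move_le n m i : (i <= n.+1)%N -> (input_move n m i <= n.+1)%N.
Proof. by case: m => //= H; lia. Qed.

Lemma map_reg0 : map_mx ratr (v_reg0 V) = map_mx intr (delta_mx 0 0) :> 'cV[R[i]]_d.
Proof. by apply/matrixP => i j; rewrite !mxE rmorph_nat; case: (_ && _). Qed.

Lemma cmulZ F z (v : 'cV[int]_d) :
  cmul F (z *: map_mx intr v) = z *: map_mx intr (F *m v).
Proof. by rewrite /cmul -scalemxAr map_mxM. Qed.

(** * Soundness through integrality *)

Lemma sqnorm_int_ge1 (v : 'cV[int]_d) : v != 0 ->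
  1 <= sqnorm (map_mx intr v : 'cV[R[i]]_d).
Proof.
move=> v0; have [j vj0] : exists j, v j 0 != 0.
  apply/existsP; rewrite -negb_forall; apply: contra v0 => /forallP vz.
  by apply/eqP/matrixP => j k; rewrite ord1 mxE; exact/eqP/vz.
apply: le_trans (coord_le_sqnorm _ j).
rewrite mxE -(rmorph_int (real_complex R)) sqr_normc_real -rmorphXn /= ler1z.
by have := exprn_even_gt0 (v j 0) (isT : ~~ odd 2); rewrite vj0 orbT gtz0_ge1.
Qed.

(** [B *m v] is a nonzero integer vector, hence of norm at least 1, while coordinate 0 of [v] is
    exactly 1; the unknown scalar [z] multiplies both. *)
Lemma weight_le_check z (v : 'cV[int]_d) (B : 'M[int]_d) : v 0 0 = 1 -> B *m v != 0 ->
  weight (z *: map_mx intr v) <= sqnorm (cmul B (z *: map_mx intr v)).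
Proof.
move=> v0 Bv; rewrite cmulZ sqnormZ /weight !mxE v0 mulr1 ler_peMr ?sqr_ge0 //.
exact: sqnorm_int_ge1.
Qed.

Lemma accept_within_ask P x t c q : c_state c = ask q ->
  accept_within P x t.+1 c = accept_within P x t (comm_step P x c).
Proof. by move=> /= ->. Qed.

(** The invariant as long as all checks have held: the register is a multiple of a vector from which
    no script accepts. [wind] needs no condition, since it resets the register. *)
Definition track x c : Prop :=
  match c_state c with
  | wind => True
  | halted _ => False
  | ask q => exists z v, [/\ c_reg c = z *: map_mx intr v, v 0 0 = 1 &
                           forall s, ~ cm_accepts x s q (c_input c) v]
  | exec q a => exists z v, [/\ c_reg c = z *: map_mx intr v, v 0 0 = 1 &
                           forall s, ~ cm_accepts x (a :: s) q (c_input c) v]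
  end.

(* Off track, the weight of coordinate 0 bounds what the round can still gain.
   When a check first fails, this gain is at most [rate ^+ 2] times the weight,
   while the verifier rejects with probability at least [rate] times the weight. *)
Lemma accept_within_le_third P x t c :
  (forall s, ~ cm_accepts x s (cm_start M) (size x) (delta_mx 0 0)) ->
  (c_input c <= (size x).+1)%N -> sqnorm (c_reg c) <= 1 ->
  ((forall b, c_state c <> halted b) ->
     accept_within P x t c <= 3^-1 + rate * weight (c_reg c)) /\
  (track x c -> accept_within P x t c <= 3^-1).
Proof.
move=> no.
have k0 := rate_gt0; have k4 := rate_le.
have w0 psi : 0 <= weight psi by exact: sqr_ge0.
have e0 : 0 <= 3^-1 :> R by lra.
have ew0 psi : 0 <= 3^-1 + rate * weight psi.
  by rewrite addr_ge0 // mulr_ge0 // ltW.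
(* Both bounds go through one induction: after a failed check, the on-track bound needs the
   off-track one. *)
elim: t c => [|t IH] c ic nc.
  rewrite /track /=; case: (c_state c) => [[[]|b]|[q|[q a]]] //=.
  by split=> // /(_ b).
case Ec : (c_state c) => [[[]|b]|[q|[q a]]].
- have le3 : accept_within P x t.+1 c <= 3^-1.
    rewrite accept_within_wind //; move: ic; rewrite leq_eqVlt ltnS => /orP[/eqP ic|ic].
      have [sc' ic' rc' _] := read_step_wind_end Ec ic.
      apply: (IH _ _ (sqnorm_read_step _ _ _)).2; first by rewrite ic'.
      rewrite /track sc' ic' rc' map_reg0; exists 1, (delta_mx 0 0).
      by rewrite scale1r mxE !eqxx.
    have [sc' ic' _] := read_step_wind Ec ic.
    by apply: (IH _ _ (sqnorm_read_step _ _ _)).2; rewrite ?/track ?sc' ?ic'.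
  by split=> // _; apply: le_trans le3 _; rewrite lerDl mulr_ge0 // ltW.
- by rewrite /track Ec; split=> // /(_ b).
- rewrite (accept_within_ask _ _ _ Ec).
  case Er: (P x (rcons (c_hist c) (main true))) => [[a|]|g]; last 1 first.
  + have sc' : c_state (comm_step P x c) = halted false by rewrite /= Ec Er.
    by rewrite (accept_within_halted _ _ _ sc').
  + have sc' : c_state (comm_step P x c) = exec q a by rewrite /= Ec Er.
    have [IH1 IH2] := IH (comm_step P x c) ic nc.
    split=> [_|]; first by apply: IH1 => b; rewrite sc'.
    rewrite /track Ec => -[z [v [rc v0 nv]]]; apply: IH2.
    by rewrite /track sc'; exists z, v; split=> // s; exact: nv.
  + have sc' : c_state (comm_step P x c) = halted false by rewrite /= Ec Er.
    by rewrite (accept_within_halted _ _ _ sc').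
have wind_le c' : c_state c' = wind -> c_input c' = c_input c ->
    sqnorm (c_reg c') <= 1 -> accept_within P x t c' <= 3^-1.
  by move=> sc' ic' nc'; apply: (IH _ _ nc').2; rewrite ?ic' // /track sc'.
have le_acc := accept_within_exec_le Ec wind_le.
have [sc' ic' rc' _] := read_step_exec x Ec.
have p0 g : 0 <= exec_prob x c q a g by exact: outcome_prob_ge0.
have pf := p0 (main false); have pt := p0 (main true).
case Ei: (cm_instr q a (input_at x (c_input c))) sc' ic' => [b|q' m F B] sc' ic'.
- rewrite (accept_within_halted _ _ _ sc') in le_acc.
  have pE : exec_prob x c q a (main true) = rate * weight (c_reg c) by exact: prob_halt Ei.
  split=> [_|].
    exact: le_trans le_acc (halt_bound b nc pt pf pE).
  rewrite /track Ec => -[z [v [_ _ /(_ [::])]]] /=; rewrite Ei.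
  case: b {sc' pE Ei} le_acc => // le_acc _.
  exact: le_trans le_acc (halt_fail_bound nc pt pf).
set c' := read_step _ _ _ in le_acc sc' ic' rc'.
have [|IH1 IH2] := IH c' _ (sqnorm_read_step _ _ _).
  by rewrite ic' input_move_le.
have {}IH1 : accept_within P x t c' <= 3^-1 + rate * weight (c_reg c').
  by apply: IH1 => b; rewrite sc'.
have wE := weight_step (c_reg c) Ei; rewrite -rc' -/(exec_prob _ _ _ _ _) in wE.
(* The excess over one third is [rate] times the new weight, hence on average [rate ^+ 2] times the
   present one. *)
have le_go : exec_prob x c q a (main true) * accept_within P x t c' <=
    exec_prob x c q a (main true) * 3^-1 + rate * (rate * weight (c_reg c)).
  by apply: le_trans (ler_wpM2l pt IH1) _; rewrite mulrDr mulrCA wE.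
have kk : rate * (rate * weight (c_reg c)) <= 4^-1 * (rate * weight (c_reg c)).
  by rewrite ler_wpM2r // mulr_ge0 // ltW.
have kw : 0 <= rate * weight (c_reg c) by rewrite mulr_ge0 // ltW.
split=> [_|]; first exact: le_trans le_acc (step_gain_bound nc pf le_go kk kw).
rewrite /track Ec => -[z [v [rc v0 nv]]].
(* If the check holds, the next configuration is on track; otherwise the rejected mass pays for the
   possible gain. *)
have [Bv|Bv] := eqVneq (B *m v) 0.
  have : track x c'.
    have [z'] := outcome_state_main q a (input_at x (c_input c)) (c_reg c).
    rewrite /track sc' rc' ic' => ->; rewrite rc Ei cmulZ scalerA.
    exists (z' * z), (F *m v); split=> [||s nvs]; [by []| |by apply: (nv s); rewrite /= Ei].
    by rewrite (mulmx_fst _ (cm_step_fst Ei)).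
  move=> /IH2 acc3.
  exact: le_trans le_acc (step_bound nc pf (ler_wpM2l pt acc3)).
have pfE : rate * weight (c_reg c) <= exec_prob x c q a (main false).
  rewrite /exec_prob outcome_prob_main Ei rc; apply: ler_wpM2l; first exact: ltW.
  exact: weight_le_check.
exact: le_trans le_acc (step_fail_bound nc le_go kk kw pfE).
Qed.

(** * Completeness: the honest prover and repeated rounds *)

Definition since_restart (h : seq symbol) : nat := find (pred1 restart) (rev h).

Lemma since_restart_rcons h g :
  since_restart (rcons h g) = if g == restart then 0%N else (since_restart h).+1.
Proof. by rewrite /since_restart rev_rcons. Qed.

(* A cycle of the verifier adds three symbols to the history: the one it sends,
   the reply, and the outcome. *)
Definition honest (script : seq Sigma -> seq A) : prover V :=
  fun x h => nth restart [seq act a | a <- script x] (since_restart h %/ 3).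

Section Completeness.
Variables (script : seq Sigma -> seq A) (x : seq Sigma).
Local Notation P := (honest script).
Hypothesis script_ok : cm_accepts x (script x) (cm_start M) (size x) (delta_mx 0 0).

(** On a valid script no check ever rejects: each step goes on or restarts, and a restart is worth
    at least [e]. Every action costs a factor [rate] and two steps of the verifier. *)
Lemma accept_within_ask_ge t (e : R) : 0 <= e <= 1 ->
  (forall u c, (t <= u)%N -> c_state c = wind -> (c_input c <= (size x).+1)%N ->
     e <= accept_within P x u c) ->
  forall s j q v z c u,
    drop j (script x) = s -> cm_accepts x s q (c_input c) v ->
    c_state c = ask q -> (c_input c <= (size x).+1)%N ->
    c_reg c = z *: map_mx intr v -> sqnorm (c_reg c) = 1 ->
    since_restart (c_hist c) = (3 * j)%N -> (t + 2 * size s <= u)%N ->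
    e + (1 - e) * (rate ^+ size s * weight (c_reg c)) <= accept_within P x u c.
Proof.
move=> /andP[e0 e1] wind_ge; have k0 := rate_gt0; have k4 := rate_le.
elim=> [|a s IH] j q v z c u // Ds acc sc ic rc nc hc.
case: u => [|[|u]] tu; [by move: tu => /=; lia | by move: tu => /=; lia | ].
rewrite (accept_within_ask _ _ _ sc).
(* The count is [3 * j] when the question is due; the symbol sent adds one, which division by 3
   absorbs. *)
have reply : P x (rcons (c_hist c) (main true)) = act a.
  rewrite /honest since_restart_rcons /= hc.
  have -> : ((3 * j).+1 %/ 3 = j)%N by lia.
  by rewrite -[X in nth _ _ X]addn0 -nth_drop -map_drop Ds.
set c1 := comm_step P x c.
have sc1 : c_state c1 = exec q a by rewrite /= sc reply.
have hc1 : since_restart (c_hist c1) = (3 * j).+2.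
  by rewrite /= reply !since_restart_rcons /= hc.
have wind_ge' c' : c_state c' = wind -> c_input c' = c_input c1 ->
    e <= accept_within P x u c'.
  by move=> sc' ic'; apply: wind_ge => //; [move: tu => /=; lia | rewrite ic'].
apply: le_trans (accept_within_exec_ge sc1 wind_ge').
have [sc' ic' rc' hc'] := read_step_exec x sc1.
have w0 psi : 0 <= weight psi by exact: sqr_ge0.
have kw : 0 <= rate * weight (c_reg c) by rewrite mulr_ge0 // ltW.
have nc1 : sqnorm (c_reg c1) = 1 by [].
rewrite {}nc1; move: acc => /=.
case Ei: (cm_instr q a (input_at x (c_input c))) => [b|q' m F B].
  move=> b1; rewrite Ei b1 in sc'.
  rewrite (accept_within_halted _ _ _ sc') mulr1.
  have -> : exec_prob x c1 q a (main true) = rate * weight (c_reg c) by exact: prob_halt Ei.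
  have -> : exec_prob x c1 q a (main false) = 0.
    rewrite /exec_prob outcome_prob_main Ei /= /cmul map_mx0 mul0mx.
    by rewrite /sqnorm big1 ?mulr0 // => i _; rewrite mxE Normc.normc0 expr0n.
  (* The machine may halt before the script is exhausted; one factor [rate] still dominates the
     claimed power. *)
  have ks : rate ^+ (size s).+1 <= rate by rewrite -[leRHS]expr1 ler_wiXn2l ?ltW ?rate_lt1.
  have : rate ^+ (size s).+1 * weight (c_reg c) <= rate * weight (c_reg c).
    by rewrite ler_wpM2r.
  by move=> le_w; rewrite subr0; exact: halt_gain.
move=> [Bv acc]; rewrite /= Ei in sc' ic'.
have -> : exec_prob x c1 q a (main false) = 0.
  rewrite /exec_prob outcome_prob_main [instr_mx _ _]/= Ei /= rc cmulZ Bv.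
  by rewrite sqnormZ /sqnorm big1 ?mulr0 // => i _; rewrite !mxE Normc.normc0 expr0n.
set c2 := read_step _ _ _ in sc' ic' rc' hc' *.
have wE : exec_prob x c1 q a (main true) * weight (c_reg c2) = rate * weight (c_reg c).
  by rewrite rc'; exact: weight_step Ei.
have p0 : 0 <= exec_prob x c1 q a (main true) by exact: outcome_prob_ge0.
(* At probability 0 the normalized vector would be 0 and not of norm 1; but then the weight is 0 and
   the claim reduces to [e]. *)
have [pz|pz] := eqVneq (exec_prob x c1 q a (main true)) 0.
  have wz : rate * weight (c_reg c) = 0 by rewrite -wE pz mul0r.
  by rewrite pz exprSr -mulrA wz !mulr0 addr0 mul0r add0r !subr0 mulr1.
have nc2 : sqnorm (c_reg c2) = 1 by rewrite rc' sqnorm_outcome_state_Apply.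
have [z' rc2] : exists z', c_reg c2 = z' *: map_mx intr (F *m v).
  have [z' E] := outcome_state_main q a (input_at x (c_input c1)) (c_reg c1).
  by exists (z' * z); rewrite rc' E [c_reg c1]/= [c_input c1]/= Ei rc cmulZ scalerA.
have /(ler_wpM2l p0) : e + (1 - e) * (rate ^+ size s * weight (c_reg c2)) <=
    accept_within P x u c2.
  apply: (IH j.+1 q' (F *m v) z') => //.
  - by rewrite -add1n -drop_drop Ds /= drop0.
  - by rewrite ic'.
  - by rewrite ic' input_move_le.
  - by rewrite hc' since_restart_rcons hc1 /=; lia.
  - by move: tu => /=; lia.
by rewrite exprSr -mulrA => IH2; exact: step_gain IH2 wE.
Qed.

(** One full round improves the lower bound [e]: [r] moves take the head to the right end, and one
    more reset starts the script. *)
Lemma accept_within_wind_ge t (e : R) : 0 <= e <= 1 ->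
  (forall u c, (t <= u)%N -> c_state c = wind -> (c_input c <= (size x).+1)%N ->
     e <= accept_within P x u c) ->
  forall r c u, (c_input c + r = (size x).+1)%N -> c_state c = wind ->
    (t + (2 * size (script x) + r.+1) <= u)%N ->
    e + (1 - e) * rate ^+ size (script x) <= accept_within P x u c.
Proof.
move=> e01 wind_ge; elim=> [|r IH] c [|u] ic sc tu; try lia.
  rewrite addn0 in ic; rewrite (accept_within_wind _ _ _ sc).
  have [sc' ic' rc' hc'] := read_step_wind_end sc ic.
  have w1 : weight (c_reg (read_step x c restart)) = 1.
    by rewrite rc' map_reg0 /weight !mxE !eqxx Normc.normc1 expr1n.
  suff : e + (1 - e) * (rate ^+ size (script x) * weight (c_reg (read_step x c restart)))
      <= accept_within P x u (read_step x c restart) by rewrite w1 mulr1.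
  apply: (@accept_within_ask_ge t e e01 wind_ge _ 0 (cm_start M) (delta_mx 0 0) 1) => //.
  - by rewrite drop0.
  - by rewrite ic'.
  - by rewrite ic'.
  - by rewrite rc' map_reg0 scale1r.
  - by rewrite rc' sqnorm_map_ratr ?reg0_unit.
  - by rewrite hc' since_restart_rcons.
  - by lia.
rewrite (accept_within_wind _ _ _ sc).
have ix : (c_input c <= size x)%N by lia.
have [sc' ic' _] := read_step_wind sc ix.
by apply: IH; rewrite ?ic' //; lia.
Qed.

Lemma accept_prob_honest : accept_prob R P x = 1.
Proof.
have k0 := rate_gt0; have k4 := rate_le.
set eta := rate ^+ size (script x).
have eta0 : 0 < eta by rewrite exprn_gt0.
have eta1 : eta <= 1 by rewrite exprn_ile1 //; lra.
(* A round takes at most [(size x).+2] winding steps and two steps per action. Iterating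
   [e + (1 - e) * eta] from 0 gives [1 - (1 - eta) ^+ k]. *)
apply: (@accept_prob_eq1 _ _ _ _ _ (2 * size (script x) + (size x).+2) eta).
  by rewrite eta0 eta1.
move=> k s; suff /(_ s (init_config R V)) H : forall u c,
    (k * (2 * size (script x) + (size x).+2) <= u)%N -> c_state c = wind ->
    (c_input c <= (size x).+1)%N -> 1 - (1 - eta) ^+ k <= accept_within P x u c.
  by move=> ks; apply: H.
elim: k {s} => [|k IH] u c ku sc ic.
  by rewrite expr0 subrr accept_within_ge0.
have pk : 0 <= (1 - eta) ^+ k <= 1.
  by rewrite exprn_ge0 ?exprn_ile1 //; lra.
have -> : 1 - (1 - eta) ^+ k.+1 =
    1 - (1 - eta) ^+ k + (1 - (1 - (1 - eta) ^+ k)) * eta by rewrite exprS; ring.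
apply: (accept_within_wind_ge _ IH (r := (size x).+1 - c_input c)) => //; first by lra.
  by rewrite subnKC.
by apply: leq_trans ku; rewrite mulSn addnC; lia.
Qed.
End Completeness.

Lemma soundness P x : (forall s, ~ cm_accepts x s (cm_start M) (size x) (delta_mx 0 0)) ->
  accept_prob R P x <= 3^-1.
Proof.
move=> no; apply: accept_prob_le => t.
apply: (@accept_within_le_third P x t (init_config R V) no _ _).2 => //.
by rewrite sqnorm_map_ratr // reg0_unit.
Qed.

End Verifier.

(** A prover need not be computable, so accepting scripts are obtained by choice. *)
Lemma weak_qAM1_checked_machine (R : realType) (Sigma : finType)
    (M : checked_machine Sigma) (L : set (seq Sigma)) :
  (forall x, L x <-> exists s, cm_accepts x s (cm_start M) (size x) (delta_mx 0 0)) ->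
  weak_qAM1 R (fun=> 1%N) L.
Proof.
move=> LM; have [|script scriptP] := @choice _ _ (fun x s => L x ->
    cm_accepts x s (cm_start M) (size x) (delta_mx 0 0)).
  move=> x; have [/LM [s sP]|nL] := pselect (L x); first by exists s.
  by exists [::].
exists (cm_verifier M), (honest script), 3^-1; split.
- exact: space_bounded_cm_verifier.
- by rewrite ltf_pV2 ?posrE // ltr_nat.
- by move=> x /scriptP; exact: accept_prob_honest.
- by move=> x nL P'; apply: soundness => s sP; apply: nL; apply/LM; exists s.
Qed.

(** * Simulating a Turing machine *)

Definition vec4 (a l r y : int) : 'cV[int]_4 := \col_i nth 0 [:: a; l; r; y] i.

(** Rows may be cut short: missing entries and rows are 0, by the default of [nth]. *)
Definition mx4 (rows : seq (seq int)) : 'M[int]_4 :=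
  \matrix_(i, j) nth 0 (nth [::] rows i) j.

Lemma mul_mx4 rows a l r y : mx4 rows *m vec4 a l r y =
  \col_i \sum_(j < 4) nth 0 (nth [::] rows i) j * nth 0 [:: a; l; r; y] j.
Proof.
by apply/matrixP => i k; rewrite !mxE; apply: eq_bigr => j _; rewrite !mxE.
Qed.

Ltac mx4_ring :=
  rewrite mul_mx4; apply/matrixP => -[[|[|[|[|?]]]] ?] ? //;
  rewrite !mxE !big_ord_recl big_ord0 /=; ring.

Section Simulation.
Variables (Sigma : finType) (M : turing_machine Sigma).
Local Notation S := (tm_symbol M).
Local Notation blank := (tm_blank M).
Implicit Types (s h : S) (d : bool).

Definition base : nat := #|S|.+1.
(** The blank is the digit 0, so an endless blank tail adds nothing and an empty stack pops a blank.
    All other digits are positive, hence [#|S|.+1] as base. *)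
Definition code s : nat := if s == blank then 0%N else (enum_rank s).+1.

Lemma code_blank : code blank = 0%N.
Proof. by rewrite /code eqxx. Qed.

Lemma code_lt s : (code s < base)%N.
Proof. by rewrite /code; case: eqP => // _; rewrite !ltnS. Qed.

Lemma code_inj : injective code.
Proof.
move=> s1 s2; rewrite /code; case: eqP => [->|_]; case: eqP => [->|_] // [].
by move/val_inj/enum_rank_inj.
Qed.

Fixpoint stack_val (w : seq S) : nat :=
  if w is s :: w' then (code s + base * stack_val w')%N else 0%N.

Lemma stack_valE w :
  stack_val w = (code (head blank w) + base * stack_val (behead w))%N.
Proof. by case: w => //=; rewrite code_blank muln0. Qed.

(** Two digits differ by less than [base], so quotient and remainder are unique even among all
    integers [y]: a prover who counts too far or not far enough has no digit left to announce. *)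
Lemma digit_inj s (y : int) w :
  (code s)%:Z + base%:Z * y = (stack_val w)%:Z ->
  s = head blank w /\ y = (stack_val (behead w))%:Z.
Proof.
rewrite stack_valE PoszD PoszM => E.
have lt1 := code_lt s; have lt2 := code_lt (head blank w).
have b0 : (0 < base)%N by [].
have yE : y = (stack_val (behead w))%:Z by nia.
by split=> //; apply: code_inj; move: E; rewrite yE => /addIr [].
Qed.

(* Coordinates 1 and 2 are the left and the right stack, 3 is a quotient under
   construction; [true] stands for left. *)
Definition vec d (p o y : int) : 'cV[int]_4 :=
  if d then vec4 1 p o y else vec4 1 o p y.

Definition push d s : 'M[int]_4 :=
  if d then mx4 [:: [:: 1]; [:: (code s)%:Z; base%:Z]; [:: 0; 0; 1]; [:: 0; 0; 0; 1]]
  else mx4 [:: [:: 1]; [:: 0; 1]; [:: (code s)%:Z; 0; base%:Z]; [:: 0; 0; 0; 1]].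

Definition dec d : 'M[int]_4 :=
  if d then mx4 [:: [:: 1]; [:: - base%:Z; 1]; [:: 0; 0; 1]; [:: 1; 0; 0; 1]]
  else mx4 [:: [:: 1]; [:: 0; 1]; [:: - base%:Z; 0; 1]; [:: 1; 0; 0; 1]].

Definition pop_mx d : 'M[int]_4 :=
  if d then mx4 [:: [:: 1]; [:: 0; 0; 0; 1]; [:: 0; 0; 1]]
  else mx4 [:: [:: 1]; [:: 0; 1]; [:: 0; 0; 0; 1]].

Definition pop_check d s : 'M[int]_4 :=
  if d then mx4 [:: [:: - (code s)%:Z; 1]] else mx4 [:: [:: - (code s)%:Z; 0; 1]].

Arguments push : simpl never.
Arguments dec : simpl never.
Arguments pop_mx : simpl never.
Arguments pop_check : simpl never.

Lemma push_vec d s p o y :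
  push d s *m vec d p o y = vec d ((code s)%:Z + base%:Z * p) o y.
Proof.
by case: d; mx4_ring.
Qed.

Lemma dec_vec d p o y : dec d *m vec d p o y = vec d (p - base%:Z) o (y + 1).
Proof.
by case: d; mx4_ring.
Qed.

Lemma pop_mx_vec d p o y : pop_mx d *m vec d p o y = vec d y o 0.
Proof.
by case: d; mx4_ring.
Qed.

Lemma pop_check_vec d s p o y :
  pop_check d s *m vec d p o y = 0 <-> p = (code s)%:Z.
Proof.
split=> [/matrixP/(_ 0 0)|->].
  by case: d; rewrite mul_mx4 !mxE !big_ord_recl big_ord0 /= => E; lia.
by case: d; mx4_ring.
Qed.

(** The scanned symbol is kept in the finite state [run q h]; the quotient counter is 0 between
    pops. *)
Definition tape_vec (t : tape S) : 'cV[int]_4 :=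
  vec4 1 (stack_val (tleft t)) (stack_val (tright t)) 0.

(* The tape whose head has just come from [o] and is to read the top of [w]. *)
Definition tape_pop d (o w : seq S) : tape S :=
  if d then Tape (behead w) (head blank w) o else Tape o (head blank w) (behead w).

Lemma thead_tape_pop d o w : Defs.thead (tape_pop d o w) = head blank w.
Proof. by case: d. Qed.

Lemma tape_pop_vec d o w :
  tape_vec (tape_pop d o w) = vec d (stack_val (behead w)) (stack_val o) 0.
Proof. by case: d. Qed.

Lemma push_tape_vec d s (t : tape S) : push d s *m tape_vec t =
  if d then tape_vec (Tape (s :: tleft t) (Defs.thead t) (tright t))
  else tape_vec (Tape (tleft t) (Defs.thead t) (s :: tright t)).
Proof.
case: d; rewrite /tape_vec /= PoszD PoszM.
  exact: (push_vec true).
exact: (push_vec false).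
Qed.

(** [scan] loads the input from right to left onto the right stack, [run q h] performs a step of the
    machine, and [pop d q] waits for the next scanned symbol. *)
Definition sim_state : finType := (unit + tm_state M * S + bool * tm_state M)%type.
Local Notation scan := (inl (inl tt)).
Local Notation run q h := (inl (inr (q, h))).
Local Notation pop d q := (inr (d, q)).

(* To pop a digit, the prover counts out the quotient with the action [None]
   and then announces the digit [s] with [Some s]; the check succeeds only if
   both are right. *)
Definition sim_instr (p : sim_state) (a : option S) (i : input_symbol Sigma)
    : instr sim_state 4 :=
  match p with
  | scan => match i with
      | Letter l => Step scan MoveLeft (push false (tm_letter M l)) 0
      | LeftEnd => Step (pop false (tm_start M)) Stay 1%:M 0
      | RightEnd => Halt false
      end
  | run q h =>
      if q == tm_accept M then Halt true
      else if q == tm_reject M then Halt false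
      else let: (q', s, m) := tm_delta q h in
      match m with
      | Stay => Step (run q' s) Stay 1%:M 0
      | MoveRight => Step (pop false q') Stay (push true s) 0
      | MoveLeft => Step (pop true q') Stay (push false s) 0
      end
  | pop d q => match a with
      | None => Step (pop d q) Stay (dec d) 0
      | Some s => Step (run q s) Stay (pop_mx d) (pop_check d s)
      end
  end.

Lemma sim_unit p a i :
  if sim_instr p a i is Step _ _ F _ then forall j, F 0 j = (j == 0)%:R else True.
Proof.
have row1 (rows : seq (seq int)) j : mx4 ([:: 1] :: rows) 0 j = (j == 0)%:R.
  by rewrite mxE; case: j => [[|[|[|[|?]]]] ?].
have row_push d s j : push d s 0 j = (j == 0)%:R by case: d; exact: row1.
have row_id j : (1%:M : 'M[int]_4) 0 j = (j == 0)%:R by rewrite mxE eq_sym.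
case: p => [[[]|[q h]]|[d q]] /=.
- by case: i.
- case: ifP => // _; case: ifP => // _; by case: tm_delta => [[q' s] []].
- by case: a => [s|]; case: d; exact: row1.
Qed.

Definition simulator : checked_machine Sigma := {|
  cm_state := sim_state;
  cm_action := option S;
  cm_dim := 3;
  cm_start := scan;
  cm_instr := sim_instr;
  cm_unit := sim_unit |}.
Local Notation accepts := (@cm_accepts Sigma simulator).
Local Notation accepting c := (exists k, (iter k (@tm_step _ M) c).1 = tm_accept M).

(** * Correctness of the simulation *)

Lemma tm_step_delta (c : tm_config M) q s m :
  c.1 != tm_accept M -> c.1 != tm_reject M -> tm_delta c.1 (Defs.thead c.2) = (q, s, m) ->
  tm_step c = (q, tape_move blank m (tape_write s c.2)).
Proof. by rewrite /tm_step => /negbTE -> /negbTE -> ->. Qed.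

(** Counting preserves [p + base * y], so by [digit_inj] a passed check names the true top symbol
    and leaves the true rest of the stack. *)
Lemma run_sound x acts :
  (forall i (c : tm_config M),
     accepts x acts (run c.1 (Defs.thead c.2)) i (tape_vec c.2) -> accepting c) /\
  (forall i d q o w (p y : int), p + base%:Z * y = stack_val w ->
     accepts x acts (pop d q) i (vec d p (stack_val o) y) ->
     accepting (q, tape_pop d o w)).
Proof.
elim: acts => [|a acts [IHrun IHpop]]; first by split.
split=> [i c|i d q o w p y E].
  rewrite [accepts _ _ _ _ _]/=; case: eqP => [ca _|/eqP nacc]; first by exists 0%N.
  case: eqP => [//|/eqP nrej].
  case D: (tm_delta c.1 (Defs.thead c.2)) => [[q' s] m] acc.
  have cS := tm_step_delta nacc nrej D.
  suff [k kP] : accepting (tm_step c) by exists k.+1; rewrite iterSr.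
  rewrite cS; case: m acc D cS => -[_ acc] D cS.
  - rewrite push_tape_vec in acc.
    apply: (IHpop _ true q' (s :: tright c.2) (tleft c.2) (stack_val (tleft c.2)) 0 _ acc).
    by rewrite mulr0 addr0.
  - rewrite mul1mx in acc; exact: (IHrun _ (q', tape_write s c.2)) acc.
  - rewrite push_tape_vec in acc.
    apply: (IHpop _ false q' (s :: tleft c.2) (tright c.2) (stack_val (tright c.2)) 0 _ acc).
    by rewrite mulr0 addr0.
case: a => [s|] /= [chk acc].
  move/pop_check_vec: chk => ps; rewrite ps in E.
  have [sw yw] := digit_inj E.
  rewrite pop_mx_vec yw -tape_pop_vec in acc.
  apply: (IHrun _ (q, tape_pop d o w)).
  by rewrite /= thead_tape_pop -sw; exact: acc.
rewrite dec_vec in acc; apply: IHpop acc.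
by rewrite -E; ring.
Qed.

(** [k] is the true quotient; the counter starts at any [y] so that the induction can peel off one
    count. *)
Lemma pop_complete x i d q o s rest (k : nat) (y : int) :
  accepts x rest (run q s) i (vec d (y + k%:Z) o 0) ->
  exists acts, accepts x acts (pop d q) i (vec d ((code s)%:Z + base%:Z * k%:Z) o y).
Proof.
elim: k y => [|k IH] y acc.
  exists (Some s :: rest); rewrite mulr0 addr0; split; first exact/pop_check_vec.
  by rewrite pop_mx_vec; rewrite addr0 in acc.
have [|acts actsP] := IH (y + 1).
  by move: acc; rewrite -addrA -intS.
exists (None :: acts); split; first by rewrite mul0mx.
rewrite dec_vec; move: actsP; congr (accepts _ _ _ _ (vec _ _ _ _)).
by rewrite intS; ring.
Qed.

Lemma tape_pop_complete x i d q o w rest :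
  accepts x rest (run q (head blank w)) i (tape_vec (tape_pop d o w)) ->
  exists acts, accepts x acts (pop d q) i (vec d (stack_val w) (stack_val o) 0).
Proof.
rewrite tape_pop_vec => acc; rewrite [stack_val w]stack_valE PoszD PoszM.
by apply: (@pop_complete _ _ _ _ _ _ rest); rewrite add0r.
Qed.

Lemma run_complete x i (c : tm_config M) : accepting c ->
  exists acts, accepts x acts (run c.1 (Defs.thead c.2)) i (tape_vec c.2).
Proof.
case=> k; elim: k c => [|k IH] c ck.
  (* [None] is a placeholder: only [pop] states consult the action. *)
  by exists [:: None]; rewrite /= ck eqxx.
have [ca|nacc] := eqVneq c.1 (tm_accept M).
  by exists [:: None]; rewrite /= ca eqxx.
have [cr|nrej] := eqVneq c.1 (tm_reject M).
  (* A rejecting configuration never changes, so it cannot lead to acceptance. *)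
  have fix_c : tm_step c = c by rewrite /tm_step cr eqxx orbT.
  by move/eqP: nacc; case; rewrite -ck iter_fix.
rewrite iterSr in ck; have [acts] := IH _ ck.
case D: (tm_delta c.1 (Defs.thead c.2)) => [[q' s] m].
rewrite (tm_step_delta nacc nrej D) => acc.
case: m D acc => D acc.
- have [acts' acc'] := @tape_pop_complete x i true q' (s :: tright c.2) (tleft c.2) acts acc.
  exists (None :: acts'); rewrite /= (negbTE nacc) (negbTE nrej) D.
  by split; [rewrite mul0mx | rewrite push_tape_vec].
- by exists (None :: acts); rewrite /= (negbTE nacc) (negbTE nrej) D mul0mx mul1mx.
- have [acts' acc'] := @tape_pop_complete x i false q' (s :: tleft c.2) (tright c.2) acts acc.
  exists (None :: acts'); rewrite /= (negbTE nacc) (negbTE nrej) D.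
  by split; [rewrite mul0mx | rewrite push_tape_vec].
Qed.

Definition init_stack (x : seq Sigma) : seq S := map (@tm_letter _ M) x.

Lemma tm_init_pop x : tm_init M x = (tm_start M, tape_pop false [::] (init_stack x)).
Proof. by rewrite /tm_init /tape_pop /init_stack; case: map. Qed.

Lemma push_init_stack x k a : ohead (drop k x) = Some a ->
  push false (tm_letter M a) *m tape_vec (Tape [::] blank (drop k.+1 (init_stack x))) =
  tape_vec (Tape [::] blank (drop k (init_stack x))).
Proof.
move=> xk; rewrite push_tape_vec /= /init_stack -!map_drop.
have -> : drop k.+1 x = behead (drop k x) by rewrite -drop1 drop_drop add1n.
by case: drop xk => //= b w [->].
Qed.

(** Cell [i.+1] holds the letter of index [i], so with the head on cell [i] the letters from index
    [i] on are stacked, leftmost on top. At cell 0 the first pop supplies the scanned symbol. *)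
Lemma scan_sound x acts i : (i <= size x)%N ->
  accepts x acts scan i (tape_vec (Tape [::] blank (drop i (init_stack x)))) ->
  accepting (tm_init M x).
Proof.
elim: acts i => [|a acts IH] [|i] //= ix; last first.
  case xi: (ohead (drop i x)) => [l|] //= [_].
  by rewrite push_init_stack //; apply: IH; exact: ltnW.
move=> [_]; rewrite mul1mx drop0 tm_init_pop.
by apply: (run_sound x acts).2; rewrite mulr0 addr0.
Qed.

Lemma scan_complete x i : (i <= size x)%N -> accepting (tm_init M x) ->
  exists acts, accepts x acts scan i (tape_vec (Tape [::] blank (drop i (init_stack x)))).
Proof.
move=> ix acc; elim: i ix => [|i IH] ix.
  have [rest] := run_complete x 0 acc; rewrite tm_init_pop thead_tape_pop.
  move=> /tape_pop_complete [acts accP].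
  by exists (None :: acts); rewrite /= mul0mx mul1mx drop0; split.
have [acts accP] := IH (ltnW ix); exists (None :: acts) => /=.
case xi: (ohead (drop i x)) => [l|] /=; first by rewrite mul0mx push_init_stack.
case E: (drop i x) xi => // _.
by move: (congr1 size E); rewrite size_drop /=; lia.
Qed.

Lemma simulatorP x : tm_accepts M x <->
  exists acts, accepts x acts scan (size x) (delta_mx 0 0).
Proof.
(* The reset register encodes the empty tape: nothing is stacked yet when the head stands on cell
   [size x]. *)
have -> : delta_mx 0 0 = tape_vec (Tape [::] blank (drop (size x) (init_stack x))).
  rewrite drop_oversize ?size_map //; apply/matrixP => -[[|[|[|[|?]]]] ?] j //;
  by rewrite !mxE ord1.
by split=> [|[acts]]; [exact: scan_complete | exact: scan_sound].
Qed.
End Simulation.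

Theorem theorem2 (R : realType) (Sigma : finType) (L : set (seq Sigma)) :
  turing_recognizable L -> weak_qAM1 R (fun _ : nat => 1%N) L.
Proof.
move=> [M LM]; apply: (@weak_qAM1_checked_machine _ _ (simulator M)) => x.
by rewrite LM; exact: simulatorP.
Qed.
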